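(* Let $R=(R,+)$ be an upper bound additive monoid, let $U$ be an almost subtractive submonoid of $R$, and let $s\in R$ with $s+s=s$. Then $$[U\,\neg\, s]_0:=\{x\in R\mid x+s\in U\}\cup\{0\}$$ is an almost subtractive submonoid of $R$.
   Context: Additive monoids are abelian with identity $0$. Write $x\le_R y$ if $x+d=y$ for some $d\in R$; $R$ is upper bound if $\le_R$ is antisymmetric. A submonoid $U$ of $R$ is almost subtractive in $R$ if for all $u,\tilde u\in U$ and $z,z'\in R$ with $u+z=u+z'=\tilde u$ one has $z=z'$. *)

(* Defs.v *)
From mathcomp Require Import all_boot all_algebra.
From mathcomp Require Import boolp classical_sets.

Set Implicit Arguments.
Unset Strict Implicit.
Unset Printing Implicit Defensive.

Import GRing.Theory.
Local Open Scope ring_scope.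
Local Open Scope classical_set_scope.

Definition monoid_le (R : nmodType) (x y : R) : Prop := exists d : R, x + d = y.

Definition upper_bound_monoid (R : nmodType) : Prop :=
  forall x y : R, monoid_le x y -> monoid_le y x -> x = y.

(* [mem] turns a Prop-valued set into the boolean collective predicate that
   [Algebra.nmod_closed] expects. *)
Definition submonoid (R : nmodType) (U : set R) : Prop := Algebra.nmod_closed (mem U).

Definition almost_subtractive (R : nmodType) (U : set R) : Prop :=
  forall u u' z z' : R, U u -> U u' -> u + z = u' -> u + z' = u' -> z = z'.

(* Written $[U \neg s]_0$ in the mathematical notation. *)
Definition neg0 (R : nmodType) (U : set R) (s : R) : set R :=
  [set x | U (x + s)] `|` [set 0].

(* Main.v *)
Require Import Defs.
From mathcomp Require Import all_boot all_algebra.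
From mathcomp Require Import boolp classical_sets.

Import GRing.Theory.
Local Open Scope ring_scope.
Local Open Scope classical_set_scope.

(** Idempotence of [s] gives (x + y) + s = (x + s) + (y + s), whence closure under addition. For
    almost subtractivity, adding [s] to u + z = u + z' = u' moves the equations into [U], where z
    and z' can be compared. The adjoined [0] is harmless as u, and as u' it forces u = 0 by
    [upper_bound_addr_eq0]. *)

Lemma submonoidP (R : nmodType) (U : set R) :
  submonoid U <-> U 0 /\ (forall x y, U x -> U y -> U (x + y)).
Proof.
split=> [[U0 UD]|[U0 UD]].
  split=> [|x y Ux Uy]; first exact: set_mem U0.
  by apply: set_mem; apply: UD; apply: mem_set.
split=> [|x y Ux Uy]; first exact: mem_set.
by apply: mem_set; apply: UD; apply: set_mem.
Qed.

(** [0] lies below every element for [monoid_le], and [y] witnesses that [x] lies below [0];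
    antisymmetry concludes. *)
Lemma upper_bound_addr_eq0 (R : nmodType) (x y : R) :
  upper_bound_monoid R -> x + y = 0 -> x = 0.
Proof.
by move=> ubR xy0; apply: ubR; [exists y | exists x; rewrite add0r].
Qed.

Lemma submonoid_neg0 (R : nmodType) (U : set R) (s : R) :
  submonoid U -> s + s = s -> submonoid (neg0 U s).
Proof.
move=> /submonoidP[_ UD] ss; apply/submonoidP; split; first by right.
move=> x y [Ux|->] [Uy|->]; rewrite ?add0r ?addr0; [|by left|by left|by right].
by left; rewrite /= -ss addrACA; apply: UD.
Qed.

Lemma almost_subtractive_neg0 (R : nmodType) (U : set R) (s : R) :
  upper_bound_monoid R -> almost_subtractive U -> almost_subtractive (neg0 U s).
Proof.
move=> ubR asU u u' z z' [Us|->]; last by move=> _; rewrite !add0r => -> ->.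
case=> [Us'|->] uz uz'.
  (* Both translates by [s] lie in [U], and (u + s) + z = (u + z) + s = u' + s, likewise for z'. *)
  by apply: (asU (u + s) (u' + s)) => //; rewrite addrAC ?uz ?uz'.
(* Here u' = 0, and u + s need not be related to [U] through u' + s = s. *)
have u0 := upper_bound_addr_eq0 _ _ _ ubR uz.
by move: uz uz'; rewrite u0 !add0r => -> ->.
Qed.

Theorem theorem2p1 (R : nmodType) (ubR : upper_bound_monoid R)
    (U : set R) (subU : submonoid U) (asU : almost_subtractive U)
    (s : R) (ss : s + s = s) :
  submonoid (neg0 U s) /\ almost_subtractive (neg0 U s).
Proof.
by split; [apply: submonoid_neg0 | apply: almost_subtractive_neg0].
Qed.
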